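(* Let $f,g$ be smooth real-valued functions of $(x^1,x^2)$ on an open set $D\subset\mathbb{R}^2$, and consider the dynamical system $\frac{dx^1}{dt}=f(x^1,x^2)$, $\frac{dx^2}{dt}=g(x^1,x^2)$. The curvature deviation tensor $P=(P^i_j)_{i,j=1,2}$ (row index $i$, column index $j$) associated to the second order system obtained by differentiating these equations in $t$, namely $$\frac{d^2x^1}{dt^2}=f_1y^1+f_2y^2,\qquad \frac{d^2x^2}{dt^2}=g_1y^1+g_2y^2,\qquad y^i=\frac{dx^i}{dt},$$ is given, as a function of $(x^1,x^2,y^1,y^2)$, by $$P=\frac12\begin{pmatrix}H_f\cdot y & H_g\cdot y\end{pmatrix}^{t}+\frac14 J^2(f,g),$$ where $y=(y^1,y^2)^t$, $\begin{pmatrix}H_f\cdot y & H_g\cdot y\end{pmatrix}$ is the $2\times2$ matrix with columns $H_f\cdot y$ and $H_g\cdot y$, the superscript $t$ denotes transpose, $H_f=\begin{pmatrix}f_{11}&f_{12}\\ f_{21}&f_{22}\end{pmatrix}$ is the Hessian of $f$, $H_g$ is the Hessian of $g$, and $J(f,g)=\begin{pmatrix}f_1&f_2\\ g_1&g_2\end{pmatrix}$.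
   Context: Subscripts on $f,g$ denote partial derivatives: $f_i=\partial f/\partial x^i$, $f_{ij}=\partial^2 f/\partial x^i\partial x^j$, and similarly for $g$. Repeated indices are summed over $1,\dots,n$. For a system of second order ODEs $\frac{d^2x^i}{dt^2}+2G^i(x,y,t)=0$, $i=1,\dots,n$, with $y^i=dx^i/dt$ and $G^i$ smooth, the nonlinear connection is $N^i_j=\partial G^i/\partial y^j$, the Berwald connection is $G^i_{jl}=\partial N^i_j/\partial y^l$, and the curvature deviation tensor (second KCC invariant) is $$P^i_j=-2\frac{\partial G^i}{\partial x^j}-2G^lG^i_{jl}+y^l\frac{\partial N^i_j}{\partial x^l}+N^i_lN^l_j+\frac{\partial N^i_j}{\partial t},$$ where $x^i,y^i,t$ are treated as independent variables. Here $n=2$ and $G^1=-\frac12(f_1y^1+f_2y^2)$, $G^2=-\frac12(g_1y^1+g_2y^2)$. *)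

(* Defs.v *)
From HB Require Import structures.
From mathcomp Require Import all_boot all_order all_algebra.
From mathcomp Require Import boolp classical_sets functions reals.
From mathcomp Require Import topology normedtype derive.

Set Implicit Arguments.
Unset Strict Implicit.
Unset Printing Implicit Defensive.

Import Order.TTheory GRing.Theory Num.Theory.
Import numFieldNormedType.Exports.

Local Open Scope classical_set_scope.
Local Open Scope ring_scope.

(* Points of R^n are column vectors; coordinates are numbered from 0, so the
   index i of the literature is the ordinal i - 1 here. *)

Definition pderive (R : realType) (n : nat) (i : 'I_n) (f : 'cV[R]_n -> R) :
    'cV[R]_n -> R :=
  fun x => 'D_(delta_mx i 0) f x.

Fixpoint Ck_on (R : realType) (n k : nat) (D : set 'cV[R]_n)
    (f : 'cV[R]_n -> R) : Prop :=
  (forall x, D x -> {for x, continuous f}) /\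
  (if k is k'.+1 then
     forall i : 'I_n,
       (forall x, D x -> derivable f x (delta_mx i 0)) /\
       Ck_on k' D (pderive i f)
   else True).

(* Intended for open D: only then are the values of f outside D irrelevant. *)
Definition smooth_on (R : realType) (n : nat) (D : set 'cV[R]_n)
    (f : 'cV[R]_n -> R) : Prop :=
  forall k : nat, Ck_on k D f.

Definition hessian (R : realType) (n : nat) (f : 'cV[R]_n -> R)
    (x : 'cV[R]_n) : 'M[R]_n :=
  \matrix_(i, j) pderive i (pderive j f) x.

(* Row i is the gradient of the i-th component (the library's jacobian, which
   acts on row vectors, is the transpose). *)
Definition jacobian_mx (R : realType) (n : nat) (X : 'I_n -> 'cV[R]_n -> R)
    (x : 'cV[R]_n) : 'M[R]_n :=
  \matrix_(i, j) pderive j (X i) x.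

(* KCC theory of the system x'' + 2 G(x, x', t) = 0.  The families below are
   functions of the independent variables x, y and t. *)

Definition nonlinear_connection (R : realType) (n : nat)
    (G : 'I_n -> 'cV[R]_n -> 'cV[R]_n -> R -> R)
    (i j : 'I_n) (x y : 'cV[R]_n) (t : R) : R :=
  pderive j (fun y' => G i x y' t) y.

Definition berwald_connection (R : realType) (n : nat)
    (G : 'I_n -> 'cV[R]_n -> 'cV[R]_n -> R -> R)
    (i j l : 'I_n) (x y : 'cV[R]_n) (t : R) : R :=
  pderive l (fun y' => nonlinear_connection G i j x y' t) y.

Definition deviation_tensor (R : realType) (n : nat)
    (G : 'I_n -> 'cV[R]_n -> 'cV[R]_n -> R -> R)
    (x y : 'cV[R]_n) (t : R) : 'M[R]_n :=
  \matrix_(i, j)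
    (- 2 * pderive j (fun x' => G i x' y t) x
     - 2 * (\sum_(l < n) G l x y t * berwald_connection G i j l x y t)
     + \sum_(l < n)
         y l 0 * pderive l (fun x' => nonlinear_connection G i j x' y t) x
     + \sum_(l < n)
         nonlinear_connection G i l x y t * nonlinear_connection G l j x y t
     + derive1 (fun s => nonlinear_connection G i j x y s) t).

(* Right-hand side of the second order system x''^i = sum_j (d_j X^i) y^j,
   y = x', obtained by differentiating x' = X(x) with respect to t. *)
Definition differentiated_rhs (R : realType) (n : nat)
    (X : 'I_n -> 'cV[R]_n -> R) (i : 'I_n) (x y : 'cV[R]_n) : R :=
  \sum_(j < n) pderive j (X i) x * y j 0.

(* Coefficients G bringing that system to the form x'' + 2 G = 0. *)
Definition differentiated_coef (R : realType) (n : nat)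
    (X : 'I_n -> 'cV[R]_n -> R) :
    'I_n -> 'cV[R]_n -> 'cV[R]_n -> R -> R :=
  fun i x y _ => - 2^-1 * differentiated_rhs X i x y.

Definition planar_field (R : realType) (f g : 'cV[R]_2 -> R) :
    'I_2 -> 'cV[R]_2 -> R :=
  fun i => if i == 0 then f else g.

(* Main.v *)
Require Import Defs.
From HB Require Import structures.
From mathcomp Require Import all_boot all_order all_algebra.
From mathcomp Require Import ring.
From mathcomp Require Import boolp classical_sets functions reals.
From mathcomp Require Import topology normedtype derive.

Set Implicit Arguments.
Unset Strict Implicit.
Unset Printing Implicit Defensive.

Import Order.TTheory GRing.Theory Num.Theory.
Import numFieldNormedType.Exports.

Local Open Scope classical_set_scope.
Local Open Scope ring_scope.

(** The coefficients of the differentiated system are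
    [G^i = - 1/2 sum_k (d_k X^i) y^k], linear in [y] with coefficients depending
    on [x] alone.  Hence the nonlinear connection is [N = - J / 2], with [J] the
    Jacobian matrix of [X]; the Berwald connection, a second [y]-derivative, is
    zero, and so is the time derivative of [N].  Three terms of the deviation
    tensor remain:
    - [- 2 d_j G^i = sum_k (d_j d_k X^i) y^k], the [j]-th entry of [H y] for the
      Hessian [H] of [X^i];
    - [sum_l y^l d_l N^i_j = - 1/2 sum_l (d_l d_j X^i) y^l], which is minus one
      half of the same entry because second derivatives commute;
    - [N N = J J / 4].

    The computation ([deviation_tensor_differentiated]) works in every
    dimension; the planar statement is its case [n = 2].  Its analytic content
    is the symmetry of the Hessian.  That symmetry ([derive_swap]) is proved in
    any normed space by the classical second difference argument: the second
    difference of [f] on a small parallelogram is symmetric in the two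
    directions, and two applications of the mean value theorem
    ([second_difference]) identify it with a mixed derivative at a nearby
    point. *)

(** * Derivatives along a line *)

(** The difference quotient of [f] along [v] is the constant [df]. *)
Lemma is_derive_affine (R : realType) (V W : normedModType R)
    (f : V -> W) (a v : V) (df : W) :
  (forall h : R, f (h *: v + a) = h *: df + f a) -> is_derive a v f df.
Proof.
move=> fE.
have lim_df : (fun h : R => h^-1 *: ((f \o shift a) (h *: v) - f a)) @ 0^'
    --> df.
  apply: cvg_near_cst; near=> h.
  rewrite /= fE addrK scalerA mulVf ?scale1r //.
  by near: h; exact: nbhs_dnbhs_neq.
by split; [apply/cvg_ex; exists df | exact: cvg_lim].
Unshelve. all: by end_near. Qed.

(** Turns a directional derivative in a normed space into a derivative on the
    real line, where the mean value theorem is available. *)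
Lemma is_derive_line (R : realType) (V W : normedModType R)
    (f : V -> W) (a v : V) (s : R) :
  derivable f (a + s *: v) v ->
  is_derive s 1 (fun r : R => f (a + r *: v)) ('D_v f (a + s *: v)).
Proof.
have quotE : (fun h : R => h^-1 *: (((fun r : R => f (a + r *: v)) \o shift s)
      (h *: 1) - f (a + s *: v)))
    = (fun h => h^-1 *: ((f \o shift (a + s *: v)) (h *: v) - f (a + s *: v))).
  apply/funext => h /=; congr (_ *: (f _ - _)).
  by rewrite [h *: 1]mulr1 scalerDl addrCA.
by move=> df; split; rewrite /derivable /derive quotE.
Qed.

Lemma MVT_line (R : realType) (V : normedModType R) (f : V -> R)
    (a v : V) (e : R) :
  0 < e -> (forall s : R, s \in `[0, e] -> derivable f (a + s *: v) v) ->
  exists2 s : R, s \in `]0, e[ &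
    f (a + e *: v) - f a = 'D_v f (a + s *: v) * e.
Proof.
move=> e0 df.
have [s se fE] := @MVT R (fun r => f (a + r *: v))
  (fun r => 'D_v f (a + r *: v)) 0 e e0
  (fun s hs => is_derive_line (df s (subset_itv_oo_cc hs)))
  (derivable_within_continuous
    (fun s hs => @ex_derive _ _ _ _ _ _ _ (is_derive_line (df s hs)))).
by exists s => //; rewrite scale0r addr0 subr0 in fE.
Qed.

(** * Symmetry of second derivatives *)

(** The left-hand side is the increment along [u] of the function [F] sending
    [z] to [f (z + e v) - f z].  The mean value theorem along [u] rewrites it
    as [e] times a difference of values of ['D_u f], and the mean value theorem
    along [v] applies to that difference. *)
Lemma second_difference (R : realType) (V : normedModType R) (f : V -> R)
    (a u v : V) (e : R) :
  0 < e ->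
  (forall s r : R, s \in `[0, e] -> r \in `[0, e] ->
    derivable f (a + s *: u + r *: v) u /\
    derivable ('D_u f) (a + s *: u + r *: v) v) ->
  exists2 s : R, s \in `]0, e[ & exists2 r : R, r \in `]0, e[ &
    f (a + e *: u + e *: v) - f (a + e *: u) - (f (a + e *: v) - f a)
      = 'D_v ('D_u f) (a + s *: u + r *: v) * (e * e).
Proof.
move=> e0 df.
have e_in : e \in `[0, e] by rewrite in_itv /= ltW /=.
have z_in : 0 \in `[0, e] by rewrite in_itv /= lexx ltW.
pose F z := f (z + e *: v) - f z.
have dF (s : R) : s \in `[0, e] ->
    is_derive (a + s *: u) u F
      ('D_u f (a + s *: u + e *: v) - 'D_u f (a + s *: u)).
  move=> hs; apply: is_deriveB.
    have [d _] := df s e hs e_in.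
    (* The difference quotients of a translate are those of the function at
       the translated point. *)
    have E : (fun h : R => h^-1 *: (((fun z => f (z + e *: v)) \o
        shift (a + s *: u)) (h *: u) - f (a + s *: u + e *: v)))
      = (fun h : R => h^-1 *: ((f \o shift (a + s *: u + e *: v)) (h *: u)
          - f (a + s *: u + e *: v))).
      by apply/funext => h; rewrite /= -!addrA.
    by split; rewrite /derivable /derive E.
  by apply: derivableP; have [] := df s 0 hs z_in; rewrite scale0r addr0.
have [s hs FE] := MVT_line e0 (fun s hs => @ex_derive _ _ _ _ _ _ _ (dF s hs)).
have hs' := subset_itv_oo_cc hs.
have [r hr GE] := MVT_line e0 (fun r hr => (df s r hs' hr).2).
exists s => //; exists r => //.
move: FE; rewrite (@derive_val _ _ _ _ _ _ _ (dF s hs')) GE /F.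
by rewrite -mulrA => <-.
Qed.

(** The second difference of [f] on the parallelogram at [a] spanned by [e u]
    and [e v] is symmetric in [u] and [v], so [second_difference] expresses it
    both as [e ^ 2] times a value of ['D_v ('D_u f)] and as [e ^ 2] times a
    value of ['D_u ('D_v f)], at two points of the parallelogram.  These two
    values are therefore equal, and by continuity they are arbitrarily close
    to the values at [a]. *)
Lemma derive_swap (R : realType) (V : normedModType R) (f : V -> R)
    (a u v : V) :
  (\forall z \near a, [/\ derivable f z u, derivable f z v,
    derivable ('D_u f) z v & derivable ('D_v f) z u]) ->
  {for a, continuous ('D_v ('D_u f))} ->
  {for a, continuous ('D_u ('D_v f))} ->
  'D_v ('D_u f) a = 'D_u ('D_v f) a.
Proof.
move=> near_der cuv cvu; apply/eqP; rewrite -subr_eq0 -normr_le0.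
apply/ler_addgt0Pr => eps eps0; rewrite add0r.
have eps2 : 0 < eps / 2 by rewrite divr_gt0.
have Cuv : \forall z \near a, `|'D_v ('D_u f) a - 'D_v ('D_u f) z| < eps / 2.
  by have /cvgrPdist_lt/(_ _ eps2) := cuv.
have Cvu : \forall z \near a, `|'D_u ('D_v f) a - 'D_u ('D_v f) z| < eps / 2.
  by have /cvgrPdist_lt/(_ _ eps2) := cvu.
have /nbhs_ballP[d /= d0 dP] : \forall z \near a,
    [/\ [/\ derivable f z u, derivable f z v, derivable ('D_u f) z v &
        derivable ('D_v f) z u],
      `|'D_v ('D_u f) a - 'D_v ('D_u f) z| < eps / 2 &
      `|'D_u ('D_v f) a - 'D_u ('D_v f) z| < eps / 2].
  have filter_a : Filter (nbhs a) by exact: nbhs_filter.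
  apply: (filterS _ (filterI near_der (filterI Cuv Cvu))).
  by move=> z [zder [zuv zvu]]; exact: And3 zder zuv zvu.
(* The size [e] is chosen to keep the whole parallelogram in the ball; the
   summand 1 makes the inequality strict and covers [u = v = 0]. *)
pose M := `|u| + `|v| + 1.
have M0 : 0 < M by rewrite ltr_wpDl // addr_ge0.
pose e := d / M.
have e0 : 0 < e by rewrite divr_gt0.
have inball (s r : R) : s \in `[0, e] -> r \in `[0, e] ->
    ball a d (a + s *: u + r *: v).
  rewrite !in_itv /= => /andP[s0 se] /andP[r0 re].
  rewrite -ball_normE /= -addrA opprD addNKr normrN.
  rewrite (le_lt_trans (ler_normD _ _)) // !normrZ !ger0_norm //.
  have -> : d = e * `|u| + e * `|v| + e.
    by rewrite -{1}(divfK (lt0r_neq0 M0) d) -/e /M; ring.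
  by rewrite ltr_pwDr // lerD // ler_wpM2r.
have [s hs [r hr E1]] := second_difference e0
  (fun s r hs hr =>
     let: And3 (And4 du _ duv _) _ _ := dP _ (inball s r hs hr)
     in conj du duv).
have inball' (s' r' : R) : s' \in `[0, e] -> r' \in `[0, e] ->
    ball a d (a + s' *: v + r' *: u).
  by move=> *; rewrite addrAC; exact: inball.
have [s' hs' [r' hr' E2]] := second_difference e0
  (fun s r hs hr =>
     let: And3 (And4 _ dv _ dvu) _ _ := dP _ (inball' s r hs hr)
     in conj dv dvu).
have [_ A _] := dP _
  (inball _ _ (subset_itv_oo_cc hs) (subset_itv_oo_cc hr)).
have [_ _ B] := dP _
  (inball' _ _ (subset_itv_oo_cc hs') (subset_itv_oo_cc hr')).
have EE : 'D_v ('D_u f) (a + s *: u + r *: v)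
    = 'D_u ('D_v f) (a + s' *: v + r' *: u).
  apply: (@mulIf _ (e * e)); first by rewrite mulf_neq0 // gt_eqF.
  by rewrite -E1 -E2 (addrAC a (e *: v)); ring.
rewrite EE in A; move: A B.
set p := 'D_v _ a; set q := 'D_u _ a; set m := 'D_u _ _ => A B.
rewrite (_ : p - q = (p - m) - (q - m)); last by ring.
rewrite [leRHS]splitr; apply: le_trans (ler_normB _ _) _.
exact: ltW (ltrD A B).
Unshelve. all: by end_near. Qed.

Lemma pderive_swap (R : realType) (n : nat) (D : set 'cV[R]_n)
    (f : 'cV[R]_n -> R) (i j : 'I_n) (x : 'cV[R]_n) :
  open D -> Ck_on 2 D f -> D x ->
  pderive i (pderive j f) x = pderive j (pderive i f) x.
Proof.
move=> openD /= [_ C2] Dx.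
have [di [_ ddi]] := C2 i; have [dj [_ ddj]] := C2 j.
apply: (derive_swap (u := delta_mx j 0) (v := delta_mx i 0)).
- near=> z.
  have Dz : D z by near: z; exact: open_nbhs_nbhs.
  exact: And4 (dj z Dz) (di z Dz) ((ddj i).1 z Dz) ((ddi j).1 z Dz).
- exact: (ddj i).2.1 x Dx.
- exact: (ddi j).2.1 x Dx.
Unshelve. all: by end_near. Qed.

(** * The deviation tensor of a differentiated system *)

(** The coefficients are linear forms in [y], so the connection does not depend
    on [y]; it is minus one half of the Jacobian matrix. *)
Lemma differentiated_nonlinear_connection (R : realType) (n : nat)
    (X : 'I_n -> 'cV[R]_n -> R) :
  nonlinear_connection (differentiated_coef X)
    = fun i j x _ _ => - 2^-1 * pderive j (X i) x.
Proof.
apply/funext => i; apply/funext => j; apply/funext => x.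
apply/funext => y; apply/funext => t.
apply: derive_val; apply: is_derive_affine => h.
rewrite /differentiated_coef /differentiated_rhs.
rewrite [h *: (_ * _)]mulrCA -mulrDr; congr (_ * _).
under eq_bigr do rewrite !mxE eqxx andbT mulrDr.
rewrite big_split /=; congr (_ + _).
rewrite (bigD1 j) //= eqxx mulr1 mulrC big1 ?addr0 //.
by move=> k /negPf ->; rewrite mulr0 mulr0.
Qed.

(** Put [h := (H y)_j], where [H] is the Hessian of the [i]-th component.  The
    [x]-derivative of the coefficients contributes [h], the transport term
    contributes [- h / 2] once the second derivatives are swapped, and the
    square of the connection contributes a quarter of the squared Jacobian; the
    Berwald term and the time derivative vanish. *)
Lemma deviation_tensor_differentiated (R : realType) (n : nat)
    (D : set 'cV[R]_n) (X : 'I_n -> 'cV[R]_n -> R) (x y : 'cV[R]_n) (t : R) :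
  open D -> (forall i, Ck_on 2 D (X i)) -> D x ->
  deviation_tensor (differentiated_coef X) x y t =
    2^-1 *: \matrix_(i, j) (hessian (X i) x *m y) j 0
    + 4^-1 *: (jacobian_mx X x *m jacobian_mx X x).
Proof.
move=> openD C2 Dx; apply/matrixP => i j.
(* The right-hand side is split in advance into the five contributions. *)
have -> : (2^-1 *: (\matrix_(i, j) (hessian (X i) x *m y) j 0 : 'M[R]_n)
    + 4^-1 *: (jacobian_mx X x *m jacobian_mx X x)) i j
  = - 2 * (- 2^-1 * (hessian (X i) x *m y) j 0) - 2 * 0
    + - 2^-1 * (hessian (X i) x *m y) j 0
    + 4^-1 * (jacobian_mx X x *m jacobian_mx X x) i j + 0.
  by rewrite !mxE; field.
rewrite [LHS]mxE /berwald_connection differentiated_nonlinear_connection.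
have dd k l : derivable (pderive k (X i)) x (delta_mx l 0).
  by have [_ /(_ k)[_ [_ /(_ l)[+ _]]]] := C2 i; exact.
have dG : pderive j (fun x' => differentiated_coef X i x' y t) x
    = - 2^-1 * (hessian (X i) x *m y) j 0.
  rewrite mxE; apply: derive_val.
  have -> : (fun x' => differentiated_coef X i x' y t)
      = - 2^-1 \*: (\sum_(k < n) y k 0 \*: pderive k (X i)).
    apply/funext => z; rewrite /differentiated_coef /differentiated_rhs.
    rewrite /= fct_sumE; congr (_ * _); apply: eq_bigr => k _.
    by rewrite [LHS]mulrC.
  apply: is_deriveZ.
  rewrite (eq_bigr (fun k => y k 0 *: 'D_(delta_mx j 0) (pderive k (X i)) x)).
    apply: is_derive_sum => k; apply: is_deriveZ; exact: derivableP.
  by move=> k _; rewrite mxE mulrC.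
have berwald0 : \sum_(l < n) differentiated_coef X l x y t *
    pderive l (fun _ => - 2^-1 * pderive j (X i) x) y = 0.
  rewrite big1 // => l _; apply/eqP; rewrite mulf_eq0; apply/orP; right.
  exact/eqP/derive_cst.
have transport : \sum_(l < n)
    y l 0 * pderive l (fun x' => - 2^-1 * pderive j (X i) x') x
    = - 2^-1 * (hessian (X i) x *m y) j 0.
  rewrite mxE mulr_sumr; apply: eq_bigr => l _.
  rewrite [RHS]mulrA [RHS]mulrC; congr (_ * _).
  rewrite mxE (pderive_swap j l openD (C2 i) Dx).
  by apply: derive_val; apply: (is_deriveZ (- 2^-1) (derivableP (dd j l))).
have NN : \sum_(l < n)
    - 2^-1 * pderive l (X i) x * (- 2^-1 * pderive j (X l) x)
    = 4^-1 * (jacobian_mx X x *m jacobian_mx X x) i j.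
  by rewrite mxE mulr_sumr; apply: eq_bigr => l _; rewrite !mxE; field.
congr (- 2 * _ - 2 * _ + _ + _ + _).
- exact: dG.
- exact: berwald0.
- exact: transport.
- exact: NN.
- exact: derive1_cst.
Qed.

Theorem proposition3p1 (R : realType) (D : set 'cV[R]_2)
    (f g : 'cV[R]_2 -> R) (openD : open D)
    (smooth_f : smooth_on D f) (smooth_g : smooth_on D g)
    (x y : 'cV[R]_2) (t : R) (Dx : D x) :
  deviation_tensor (differentiated_coef (planar_field f g)) x y t =
    2^-1 *: (row_mx (hessian f x *m y) (hessian g x *m y) : 'M[R]_2)^T
    + 4^-1 *: (jacobian_mx (planar_field f g) x
               *m jacobian_mx (planar_field f g) x).
Proof.
rewrite (deviation_tensor_differentiated y t openD _ Dx); last first.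
  by move=> i; rewrite /planar_field; case: ifP.
(* Transposing turns the two columns of the block matrix into the two rows
   indexed by [f] and [g]; the cases are [i = 0] and [i = 1]. *)
congr (_ *: _ + _); apply/matrixP => i j; rewrite [LHS]mxE [RHS]mxE.
case: (@split_ordP 1 1 i) => k ->; rewrite ord1 /planar_field.
  exact/esym/(@row_mxEl R 2 1 1).
exact/esym/(@row_mxEr R 2 1 1).
Qed.
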